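(* Let $p:E\to T$ be a genus one fibration satisfying the standing conditions of the context, $(n,d)$ coprime integers, $M$, $\mathcal P$, $\omega$ as in the context, and let $V\subset M\times_T\breve E$ be a small open neighbourhood of a point $o$. Let $\xi,\zeta:\mathcal P|_V\to V\times\mathbb C^n$ be two trivializations of the universal family and let $\phi=\phi(v,y):V\to\mathrm{GL}_n(\mathbb C)$ be the holomorphic function with $\zeta=(\mathrm{id}\times\phi)\circ\xi$. Then the associated solutions $r^\xi$ and $r^\zeta$ of the associative Yang--Baxter equation are gauge equivalent, the equivalence being given by $\phi$: $$r^\zeta(v_1,v_2;y_1,y_2)=\bigl(\phi(v_1,y_1)\otimes\phi(v_2,y_2)\bigr)\,r^\xi(v_1,v_2;y_1,y_2)\,\bigl(\phi(v_2,y_1)^{-1}\otimes\phi(v_1,y_2)^{-1}\bigr).$$ In other words, gauge transformations of the solutions of the associative Yang--Baxter equation which are obtained from a geometric associative $r$-matrix correspond exactly to changes of trivialization of the universal family $\mathcal P$: conversely, applying to $r^\xi$ the gauge transformation given by a holomorphic $\phi:V\to\mathrm{GL}_n(\mathbb C)$ yields $r^\zeta$ for the trivialization $\zeta=(\mathrm{id}\times\phi)\circ\xi$.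
   Context: Standing conditions on $p:E\to T$: $p$ is a flat projective morphism of relative dimension one between reduced complex spaces, with smooth locus $\breve E\subset E$; there is a section $\imath:T\to\breve E$; every fibre $E_t$ is a reduced and irreducible projective curve of arithmetic genus one; $E\to T$ is embeddable into a smooth fibration of projective surfaces over $T$; the relative dualizing sheaf satisfies $\omega_{E/T}\cong\mathcal O_E$; and $p$ is the analytification of an algebraic fibration. $M=M^{(n,d)}_{E/T}$ with universal family $\mathcal P\in\mathrm{VB}(M\times_TE)$ represents the functor of families of stable vector bundles of rank $n$ and degree $d$ on the fibres of $p$; for $v\in M$ over $t$ put $\mathcal P^v=\mathcal P|_{\{v\}\times E_t}$. $\omega\in H^0(E,\omega_{E/T})$ is a nowhere vanishing section; its restriction $\omega_t$ is a nowhere vanishing regular differential form on $E_t$ (sections of the dualizing sheaf are identified with Rosenlicht's regular differentials). Geometric associative $r$-matrix: for $v_1\neq v_2$ in $M$ and $y_1\ne y_2$ in $\breve E$ over the same $t\in T$, define $\mathrm{res}_{y_1}:\mathrm{Hom}_{E_t}(\mathcal P^{v_1},\mathcal P^{v_2}(y_1))\to\mathrm{Hom}_{\mathbb C}(\mathcal P^{v_1}|_{y_1},\mathcal P^{v_2}|_{y_1})$ by: for a local section $s$ of $\mathcal P^{v_1}$ near $y_1$ with $F(s)=\sum_if_iw_i$ ($w_i$ local sections of $\mathcal P^{v_2}$, $f_i$ functions with at most a simple pole at $y_1$), $\mathrm{res}_{y_1}(F)(s(y_1))=\sum_i\mathrm{res}_{y_1}(f_i\omega_t)w_i(y_1)$.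 Let $\mathrm{ev}_{y_2}$ be restriction of $F$ to the fibre at $y_2$. The map $\mathrm{res}_{y_1}$ is an isomorphism; put $\tilde r=\mathrm{ev}_{y_2}\circ\mathrm{res}_{y_1}^{-1}$ and let $r=\sum_\nu a_\nu\otimes b_\nu\in\mathrm{Hom}_{\mathbb C}(\mathcal P^{v_2}|_{y_1},\mathcal P^{v_1}|_{y_1})\otimes\mathrm{Hom}_{\mathbb C}(\mathcal P^{v_1}|_{y_2},\mathcal P^{v_2}|_{y_2})$ be the tensor with $\tilde r(A)=\sum_\nu\mathrm{tr}(a_\nu A)b_\nu$. Matrix form: writing $\xi(v,y):\mathcal P^v|_y\to\mathbb C^n$ for the fibres of $\xi$, put $r^\xi(v_1,v_2;y_1,y_2)=\sum_\nu\xi(v_1,y_1)a_\nu\xi(v_2,y_1)^{-1}\otimes\xi(v_2,y_2)b_\nu\xi(v_1,y_2)^{-1}\in\mathrm{Mat}_{n\times n}(\mathbb C)\otimes\mathrm{Mat}_{n\times n}(\mathbb C)$, defined whenever all $(v_i,y_j)\in V$; similarly $r^\zeta$. Gauge equivalence: $r$ and $r'$ are gauge equivalent via $\phi$ if $r'(v_1,v_2;y_1,y_2)=(\phi(v_1;y_1)\otimes\phi(v_2;y_2))r(v_1,v_2;y_1,y_2)(\phi(v_2;y_1)^{-1}\otimes\phi(v_1;y_2)^{-1})$. *)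

(* Defs.v *)
From HB Require Import structures.
From mathcomp Require Import all_boot all_order all_algebra.
From mathcomp Require Import all_classical all_reals all_analysis.
From mathcomp Require Import complex mxtens.

Set Implicit Arguments.
Unset Strict Implicit.
Unset Printing Implicit Defensive.
Import Order.TTheory GRing.Theory Num.Theory.
Export numFieldNormedType.Exports.
Local Open Scope classical_set_scope.
Local Open Scope quotient_scope.
Local Open Scope ring_scope.

(* Registering R[i] under its own name as a numClosedFieldType gives it (and
   'rV[Cplx R]_N) the Euclidean topology, and makes [differentiable] mean
   complex differentiable, i.e. holomorphic on an open set. *)
Definition Cplx (R : realType) : numClosedFieldType := R[i].

(* A reduced complex space is a space with functions: its structure sheaf is
   a subsheaf of the sheaf of complex functions. We record the sheaf by its
   stalks: [germ x f] says that f is holomorphic near x. To form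
   subspaces and fibre products without subtypes, the points are the elements
   of a subset [supp] of an ambient type; values off [supp] are irrelevant. *)
Record rspace (R : realType) := RSpace {
  pt :> topologicalType;
  supp : set pt;
  germ : pt -> set (pt -> Cplx R) }.

Section Spaces.
Context {R : realType}.
Local Notation C := (Cplx R).
Implicit Types X Y S T E M : rspace R.

Definition nearin X (x : X) : set_system X := within (@supp R X) (nbhs x).

Definition affine (N : nat) : rspace R :=
  @RSpace R 'rV[C]_N setT
    (fun z F => \forall w \near z, differentiable F w).

(* The reduced structure induced on a subset. *)
Definition sub X (A : set X) : rspace R :=
  @RSpace R X (@supp R X `&` A)
    (fun x f => exists2 g, germ x g &
       \forall y \near within (@supp R X `&` A) (nbhs x), f y = g y).

(* f is holomorphic near (x, y) on X * Y when it is a holomorphic function of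
   finitely many holomorphic functions on X near x and on Y near y. *)
Definition prodX X Y : rspace R :=
  @RSpace R (X * Y)%type (@supp R X `*` @supp R Y)
    (fun u f => exists (k l : nat) (a : 'I_k -> X -> C) (b : 'I_l -> Y -> C)
                       (F : 'rV[C]_(k + l) -> C),
       let ab (w : X * Y) := row_mx (\row_i a i w.1) (\row_j b j w.2) in
       [/\ forall i, germ u.1 (a i), forall j, germ u.2 (b j),
           @germ R (affine (k + l)) (ab u) F &
           \forall w \near within (@supp R X `*` @supp R Y) (nbhs u),
             f w = F (ab w)]).

Definition fprod X Y T (q : X -> T) (p : Y -> T) : rspace R :=
  sub (X := prodX X Y) [set u : X * Y | q u.1 = p u.2].

Definition fibre E T (p : E -> T) (t : T) : rspace R :=
  sub (X := E) [set x | p x = t].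

Definition holmap X Y (f : X -> Y) : Prop :=
  [/\ forall x, supp x -> @supp R Y (f x),
      {within @supp R X, continuous f} &
      forall x, supp x -> forall g, germ (f x) g -> germ x (g \o f)].

Definition biholo X Y (f : X -> Y) (g : Y -> X) : Prop :=
  [/\ holmap f, holmap g, forall x, supp x -> g (f x) = x &
      forall y, supp y -> f (g y) = y].

(* A local model: the common zeros in an open set D of finitely many
   holomorphic functions on D. *)
Definition local_model N (D : set 'rV[C]_N) k (g : 'I_k -> 'rV[C]_N -> C)
    : rspace R :=
  sub (X := affine N) [set z | D z /\ forall j, g j z = 0].

Definition complex_space X : Prop :=
  [/\ forall x y : X, supp x -> supp y -> x <> y ->
        exists U W : set X, [/\ open U, open W, U x, W y &
                                U `&` W `&` @supp R X = set0],
      forall (x : X) f g, supp x -> germ x f ->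
        (\forall y \near nearin x, f y = g y) -> germ x g &
      forall x : X, supp x ->
        exists (W : set X) N (D : set 'rV[C]_N) k
               (g : 'I_k -> 'rV[C]_N -> C) h h',
          [/\ open W, W x, open D,
              forall j z, D z -> differentiable (g j) z &
              biholo (X := sub W) (Y := local_model D g) h h']].

Definition manifold_at (d : nat) X (x : X) : Prop :=
  exists (W : set X) (O : set 'rV[C]_d) h h',
    [/\ open W, W x, open O & biholo (X := sub W) (Y := sub (X := affine d) O) h h'].

(* The manifold points are dense in a reduced space. *)
Definition pure_dim (d : nat) X : Prop :=
  forall (x : X) U, supp x -> open U -> U x ->
    exists y : X, [/\ supp y, U y & manifold_at d y].

Definition analytic_subset X (A : set X) : Prop :=
  A `<=` @supp R X /\
  forall x : X, supp x -> exists k (g : 'I_k -> X -> C),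
    (forall j, germ x (g j)) /\
    \forall y \near nearin x, A y <-> forall j, g j y = 0.

Definition irreducible_space X : Prop :=
  (exists x : X, supp x) /\
  forall A B : set X, analytic_subset A -> analytic_subset B ->
    A `|` B = @supp R X -> A = @supp R X \/ B = @supp R X.

Definition closed_embedding X Y (i : X -> Y) : Prop :=
  [/\ holmap i,
      exists2 K : set Y, closed K & i @` @supp R X = K `&` @supp R Y &
      exists2 i' : Y -> X, holmap (X := sub (i @` @supp R X)) (Y := X) i' &
        forall x, supp x -> i' (i x) = x].

(* [p] is at [x] a projection T x C^d -> T. *)
Definition smooth_at (d : nat) E T (p : E -> T) (x : E) : Prop :=
  exists (W : set E) (O : set (T * 'rV[C]_d)) h h',
    [/\ open W, W x, open O,
        biholo (X := sub W) (Y := sub (X := prodX T (affine d)) O) h h' &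
        forall y, supp y -> W y -> (h y).1 = p y].

Definition smooth_locus E T (p : E -> T) : set E :=
  [set x | supp x /\ smooth_at 1 p x].


Definition proportional N (u v : 'rV[C]_N) : bool :=
  `[< exists2 c : C, c != 0 & u = c *: v >].

Lemma proportional_equiv N : equiv_class_of (@proportional N).
Proof.
split=> [u | u v | v u w].
- by apply/asboolP; exists 1; rewrite ?oner_eq0 ?scale1r.
- suff sym x y : @proportional N x y -> proportional y x.
    by apply/idP/idP; apply: sym.
  move=> /asboolP[c c0 ->]; apply/asboolP; exists c^-1; first by rewrite invr_eq0.
  by rewrite scalerA mulVf// scale1r.
- move=> /asboolP[c c0 ->] /asboolP[b b0 ->]; apply/asboolP.
  by exists (c * b); rewrite ?mulf_neq0// scalerA.
Qed.

Canonical proportional_equivRel N := EquivRelPack (@proportional_equiv N).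

Definition proj_pt (N : nat) : Type :=
  quotient_topology {eq_quot @proportional N.+1}.

HB.instance Definition _ N := Topological.on (proj_pt N).

Definition proj_class N (u : 'rV[C]_N.+1) : proj_pt N :=
  \pi_{eq_quot @proportional N.+1} u.

Definition proj (N : nat) : rspace R :=
  @RSpace R (proj_pt N) [set x | exists2 u, u != 0 & x = proj_class u]
    (fun x f => forall u, u != 0 -> x = proj_class u ->
       \forall w \near u, differentiable (f \o @proj_class N) w).

(* Locally over T, a closed subspace of T x P^N. *)
Definition projective_morphism E T (p : E -> T) : Prop :=
  forall t : T, supp t -> exists (O : set T) N (i : E -> proj N),
    [/\ open O, O t &
        closed_embedding (X := sub (p @^-1` O)) (Y := prodX (sub O) (proj N))
          (fun x => (p x, i x))].

Definition projective_space X : Prop :=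
  exists N (i : X -> proj N), closed_embedding i.

(* An algebraic structure on a complex space is a finite atlas by affine algebraic
   sets with regular transition functions. *)

Inductive polyfun N : ('rV[C]_N -> C) -> Prop :=
| polyfun_cst c : polyfun (fun=> c)
| polyfun_coord j : polyfun (fun z => z 0 j)
| polyfun_add P Q : polyfun P -> polyfun Q -> polyfun (fun z => P z + Q z)
| polyfun_mul P Q : polyfun P -> polyfun Q -> polyfun (fun z => P z * Q z).

Definition zclosed N (A : set 'rV[C]_N) : Prop :=
  exists J : set ('rV[C]_N -> C),
    (forall P, J P -> polyfun P) /\ A = [set z | forall P, J P -> P z = 0].

Definition zopen_in N (A B : set 'rV[C]_N) : Prop :=
  exists2 Z, zclosed Z & B = A `\` Z.

Definition regular_on N (B : set 'rV[C]_N) (f : 'rV[C]_N -> C) : Prop :=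
  forall z, B z -> exists P Q, [/\ polyfun P, polyfun Q, Q z != 0 &
    forall w, B w -> Q w != 0 -> f w = P w / Q w].

Record atlas X := Atlas {
  asize : nat;
  adom : 'I_asize -> set X;
  adim : 'I_asize -> nat;
  aset : forall i, set 'rV[C]_(adim i);
  aco : forall i, X -> 'rV[C]_(adim i);
  ainv : forall i, 'rV[C]_(adim i) -> X }.
Arguments aset {X} a i.
Arguments aco {X} a i _.
Arguments ainv {X} a i _.

(* The image in the i-th affine chart of a set of points. *)
Definition ashadow X (a : atlas X) (i : 'I_(asize a)) (A : set X) :
    set 'rV[C]_(adim i) :=
  aco a i @` (@supp R X `&` adom i `&` A).
Arguments ashadow {X a} i A _.

Definition algebraic_atlas X (a : atlas X) : Prop :=
  [/\ forall x : X, supp x -> exists i : 'I_(asize a), adom i x,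
      forall i : 'I_(asize a),
        [/\ open (adom i), zclosed (aset a i) &
            biholo (X := sub (adom i)) (Y := sub (X := affine _) (aset a i))
              (aco a i) (ainv a i)] &
      forall i j : 'I_(asize a),
        zopen_in (aset a i) (ashadow i (adom j)) /\
        forall c, regular_on (ashadow i (adom j))
                    (fun z => aco a j (ainv a i z) 0 c)].

Definition zariski_open X (a : atlas X) (O : set X) : Prop :=
  forall i : 'I_(asize a), zopen_in (aset a i) (ashadow i O).

Definition algebraic_map E T (aE : atlas E) (aT : atlas T) (p : E -> T) : Prop :=
  forall (i : 'I_(asize aE)) (j : 'I_(asize aT)),
    zopen_in (aset aE i) (ashadow i (p @^-1` adom j)) /\
    forall c, regular_on (ashadow i (p @^-1` adom j))
                (fun z => aco aT j (p (ainv aE i z)) 0 c).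

(* A map to P^N, regular on A: locally given by N + 1 polynomials. *)
Definition algebraic_map_proj E (aE : atlas E) (A : set E) N (i : E -> proj N)
    : Prop :=
  forall (k : 'I_(asize aE)) z, ashadow k A z ->
    exists P : 'I_N.+1 -> 'rV[C]_(adim k) -> C,
      [/\ forall c, polyfun (P c), exists c, P c z != 0 &
          forall w, ashadow k A w -> (exists c, P c w != 0) ->
            i (ainv aE k w) = proj_class (\row_c P c w)].

Definition analytification_of_algebraic E T (p : E -> T) : Prop :=
  exists (aE : atlas E) (aT : atlas T),
    [/\ algebraic_atlas aE, algebraic_atlas aT, algebraic_map aE aT p &
        forall t : T, supp t -> exists (O : set T) N (i : E -> proj N),
          [/\ zariski_open aT O, O t, algebraic_map_proj aE (p @^-1` O) i &
              closed_embedding (X := sub (p @^-1` O))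
                (Y := prodX (sub O) (proj N)) (fun x => (p x, i x))]].

(* N with [act] is a module over O_{T, t}; [act] takes representatives of germs. *)
Definition germ_module T (t : T) (N : zmodType) (act : (T -> C) -> N -> N) : Prop :=
  [/\ forall f g m, germ t f -> germ t g ->
        (\forall s \near nearin t, f s = g s) -> act f m = act g m,
      forall m, act (fun=> 1) m = m,
      forall f g m, germ t f -> germ t g ->
        act (fun s => f s + g s) m = act f m + act g m,
      forall f g m, germ t f -> germ t g ->
        act (fun s => f s * g s) m = act f (act g m) &
      forall f m m', germ t f -> act f (m + m') = act f m + act f m'].

Definition balanced E T (p : E -> T) (x : E) (N W : zmodType)
    (act : (T -> C) -> N -> N) (b : N -> (E -> C) -> W) : Prop :=
  [/\ forall m g h, germ x g -> germ x h ->
        (\forall y \near nearin x, g y = h y) -> b m g = b m h,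
      forall m g h, germ x g -> germ x h ->
        b m (fun y => g y + h y) = b m g + b m h,
      forall m m' g, germ x g -> b (m + m') g = b m g + b m' g &
      forall m f g, germ (p x) f -> germ x g ->
        b (act f m) g = b m (fun y => f (p y) * g y)].

(* \sum_i m_i (x) g_i vanishes in N (x)_{O_{T, p x}} O_{E, x}, by the universal
   property of the tensor product. *)
Definition tensor_zero E T (p : E -> T) (x : E) (N : zmodType)
    (act : (T -> C) -> N -> N) k (m : 'I_k -> N) (g : 'I_k -> E -> C) : Prop :=
  forall (W : zmodType) (b : N -> (E -> C) -> W),
    balanced p x act b -> \sum_i b (m i) (g i) = 0.

Definition flat_at E T (p : E -> T) (x : E) : Prop :=
  forall (N N' : zmodType) act act' (j : N' -> N),
    germ_module (p x) act -> germ_module (p x) act' ->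
    (forall m m', j (m + m') = j m + j m') ->
    (forall f m, germ (p x) f -> j (act' f m) = act f (j m)) ->
    injective j ->
    forall k (m : 'I_k -> N') (g : 'I_k -> E -> C), (forall i, germ x (g i)) ->
      tensor_zero p x act (j \o m) g -> tensor_zero p x act' m g.

(* The ideal m_t O_{E, x}, t = p x, of the scheme-theoretic fibre. *)
Definition fibre_ideal E T (p : E -> T) (x : E) (f : E -> C) : Prop :=
  exists k (a : 'I_k -> T -> C) (b : 'I_k -> E -> C),
    [/\ forall i, germ (p x) (a i) /\ a i (p x) = 0, forall i, germ x (b i) &
        \forall y \near nearin x, f y = \sum_i a i (p y) * b i y].

Definition reduced_fibre E T (p : E -> T) (t : T) : Prop :=
  forall (x : E) f k, supp x -> p x = t -> germ x f ->
    fibre_ideal p x (fun y => f y ^+ k) -> fibre_ideal p x f.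

(* As for functions, a sheaf of sections of a family of vector spaces is given by
   its stalks: [hsec x s] says that s is a section near x. *)
Record bundle (X : Type) := Bundle {
  fib : X -> vectType C;
  hsec : forall x : X, set (forall y, fib y) }.

Definition vb X (n : nat) (P : bundle X) : Prop :=
  forall x : X, supp x -> exists e : 'I_n -> forall y, fib P y,
    \forall y \near nearin x,
      basis_of fullv [seq e i y | i : 'I_n] /\
      forall s, hsec y s <-> exists f : 'I_n -> X -> C,
        (forall i, germ y (f i)) /\
        \forall z \near nearin y, s z = \sum_i f i z *: e i z.

Definition structure_sheaf X : bundle X :=
  @Bundle X (fun=> C : vectType C) (fun x f => germ x f).

Definition pullback X (Y : Type) (f : X -> Y) (P : bundle Y) : bundle X :=
  @Bundle X (fun x => fib P (f x))
    (fun x s => exists k (g : 'I_k -> X -> C) (e : 'I_k -> forall y, fib P y),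
       [/\ forall i, germ x (g i), forall i, hsec (f x) (e i) &
           \forall z \near nearin x, s z = \sum_i g i z *: e i (f z)]).

Section Sheaf.
Context (X : rspace R) (V : X -> vectType C) (F : X -> set (forall y, V y)).

Definition sections (U : set X) : set (forall y, V y) :=
  [set s | forall y, supp y -> U y -> F y s].

(* dim H^0 = m *)
Definition h0 (m : nat) : Prop :=
  exists z : 'I_m -> forall y, V y, (forall i, sections setT (z i)) /\
    forall s, sections setT s -> exists! c : 'rV[C]_m,
      forall y, supp y -> s y = \sum_i c 0 i *: z i y.

(* Open covers indexed by the points are cofinal among all open covers. *)
Definition cover_by (U : X -> set X) : Prop :=
  forall x, supp x -> open (U x) /\ U x x.

Definition cocycle (U : X -> set X) (s : X -> X -> forall y, V y) : Prop :=
  (forall a b, supp a -> supp b -> sections (U a `&` U b) (s a b)) /\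
  forall a b c y, supp a -> supp b -> supp c -> supp y ->
    U a y -> U b y -> U c y -> s a b y + s b c y = s a c y.

Definition coboundary (U : X -> set X) (s : X -> X -> forall y, V y) : Prop :=
  exists t : X -> forall y, V y, (forall a, supp a -> sections (U a) (t a)) /\
  forall a b y, supp a -> supp b -> supp y -> U a y -> U b y ->
    s a b y = t b y - t a y.

(* dim H^1 = m, in Cech cohomology. Since H^1(U, F) -> H^1(X, F) is injective,
   classes are compared on any common refinement. *)
Definition h1 (m : nat) : Prop :=
  exists (U : X -> set X) (z : 'I_m -> X -> X -> forall y, V y),
    [/\ cover_by U, forall i, cocycle U (z i) &
        forall U' s, cover_by U' -> cocycle U' s -> exists! c : 'rV[C]_m,
          coboundary (fun x => U x `&` U' x)
            (fun a b y => s a b y - \sum_i c 0 i *: z i a b y)].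

Definition euler_char (k : int) : Prop :=
  exists a b : nat, [/\ h0 a, h1 b & k = a%:Z - b%:Z].

Definition locally_free_at (r : nat) (x : X) : Prop :=
  exists e : 'I_r -> forall y, V y, \forall y \near nearin x,
    (forall i, F y (e i)) /\
    forall s, F y s -> exists f : 'I_r -> X -> C,
      [/\ forall i, germ y (f i),
          \forall z \near nearin y, s z = \sum_i f i z *: e i z &
          forall g : 'I_r -> X -> C, (forall i, germ y (g i)) ->
            (\forall z \near nearin y, s z = \sum_i g i z *: e i z) ->
            forall i, \forall z \near nearin y, g i z = f i z].

(* Rank of a coherent sheaf on an irreducible space *)
Definition sheaf_rank (r : nat) : Prop :=
  exists A : set X, [/\ analytic_subset A, A <> @supp R X &
    forall x, supp x -> ~ A x -> locally_free_at r x].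

(* A submodule of finite type; inside a locally free sheaf it is coherent. *)
Definition coherent_subsheaf (G : X -> set (forall y, V y)) : Prop :=
  forall x, supp x ->
  [/\ G x `<=` F x,
      [/\ G x (fun y => 0 : V y),
          forall s t, G x s -> G x t -> G x (fun y => s y + t y) &
          forall f s, germ x f -> G x s -> G x (fun y => f y *: s y)],
      forall s t, G x s -> (\forall y \near nearin x, s y = t y) -> G x t,
      forall s, G x s -> \forall y \near nearin x, G y s &
      exists k (e : 'I_k -> forall y, V y), \forall y \near nearin x,
        (forall i, G y (e i)) /\
        forall s, G y s -> exists f : 'I_k -> X -> C,
          (forall i, germ y (f i)) /\
          \forall z \near nearin y, s z = \sum_i f i z *: e i z].

End Sheaf.

(* p_a = 1 - chi(O) *)
Definition arithmetic_genus X (g : nat) : Prop :=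
  euler_char (@hsec _ (structure_sheaf X)) (1 - g%:Z).

(* deg F = chi(F) - rk(F) chi(O) *)
Definition sheaf_degree X (V : X -> vectType C) (F : X -> set (forall y, V y))
    (r : nat) (d : int) : Prop :=
  exists a b : int, [/\ euler_char F a,
    euler_char (@hsec _ (structure_sheaf X)) b & d = a - r%:Z * b].

(* Slope stable vector bundle of rank n and degree d on an integral curve *)
Definition stable X (n : nat) (d : int) (P : bundle X) : Prop :=
  [/\ vb n P, sheaf_degree (@hsec _ P) n d &
      forall (G : X -> set (forall y, fib P y)) r d',
        coherent_subsheaf (@hsec _ P) G -> sheaf_rank G r -> sheaf_degree G r d' ->
        (0 < r < n)%N -> (d'%:~R / r%:R < d%:~R / n%:R :> rat)].


Section Moduli.
Context (E T : rspace R) (p : E -> T) (n : nat) (d : int).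

(* The restriction of P in VB(S x_T E) to {v} x E_t, v over t. *)
Definition restr (S : Type) (P : bundle (S * E)) (t : T) (v : S)
    : bundle (fibre p t) :=
  pullback (X := fibre p t) (fun x : E => (v, x)) P.

(* A family of stable bundles with base q : S -> T. *)
Definition stable_family S (q : S -> T) (P : bundle (S * E)) : Prop :=
  vb (X := fprod q p) n P /\
  forall s : S, supp s -> stable n d (restr P (q s) s).

(* F is isomorphic to G (x) pr_S^* L for a line bundle L on S; the isomorphism is
   given as the O-bilinear map L x G -> F. *)
Definition equivalent_families S (q : S -> T) (F G : bundle (S * E)) : Prop :=
  exists (L : bundle S)
         (th : forall u : S * E, fib L u.1 -> fib G u -> fib F u),
  vb (X := S) 1 L /\
  forall u : fprod q p, supp u ->
  [/\ forall c l l' g, th u (c *: l + l') g = c *: th u l g + th u l' g,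
      forall c l g g', th u l (c *: g + g') = c *: th u l g + th u l g',
      forall l, l != 0 -> bijective (th u l) &
      forall (l : forall s, fib L s) (g : forall w, fib G w),
        hsec u.1 l -> hsec u g -> hsec u (fun w => th w (l w.1) (g w))].

(* (M, P) represents the functor sending S -> T to the families of stable
   bundles of rank n and degree d on S x_T E, up to twists by line bundles on S.
   Bases are reduced; S x_T E is then reduced as E -> T is flat with reduced
   fibres. M being reduced, this determines (M, P). *)
Definition moduli_space M (q : M -> T) (P : bundle (M * E)) : Prop :=
  [/\ complex_space M, holmap q, stable_family q P &
      forall S (q' : S -> T) (F : bundle (S * E)),
        complex_space S -> holmap q' -> stable_family q' F ->
        let classifies (f : S -> M) :=
          [/\ holmap f, forall s, supp s -> q (f s) = q' s &
              equivalent_families q' F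
                (pullback (X := fprod q' p) (fun u : S * E => (f u.1, u.2)) P)] in
        (exists f, classifies f) /\
        forall f g, classifies f -> classifies g -> forall s, supp s -> f s = g s].

End Moduli.


Section Forms.
Context (E T : rspace R) (p : E -> T).

(* Relative tangent vectors: derivations of O_{E, y} vanishing on p^* O_T. *)
Definition reltan (y : E) (D : (E -> C) -> C) : Prop :=
  [/\ forall f g, germ y f -> germ y g ->
        (\forall z \near nearin y, f z = g z) -> D f = D g,
      forall f g, germ y f -> germ y g -> D (fun z => f z + g z) = D f + D g,
      forall c f, germ y f -> D (fun z => c * f z) = c * D f,
      forall f g, germ y f -> germ y g ->
        D (fun z => f z * g z) = D f * g y + f y * D g &
      forall a, germ (p y) a -> D (a \o p) = 0].

(* A relative form assigns to each point of the smooth locus a function of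
   relative tangent vectors; other values are irrelevant. *)
Definition relform := E -> ((E -> C) -> C) -> C.

Definition form_eq_at (x : E) (w w' : relform) : Prop :=
  \forall y \near nearin x, smooth_locus p y ->
    forall D, reltan y D -> w y D = w' y D.

(* w = \sum_i h_i dz_i near y *)
Definition holomorphic_form_at (y : E) (w : relform) : Prop :=
  exists k (h z : 'I_k -> E -> C),
    (forall i, germ y (h i) /\ germ y (z i)) /\
    \forall y' \near nearin y, forall D, reltan y' D ->
      w y' D = \sum_i h i y' * D (z i).

(* The stalk at x of omega_{E/T}, for E locally a relative hypersurface in a
   smooth surface. With E = {F = 0} in T x C^2 (coordinates x_0, x_1),
   omega_{E/T} = Ext^1(O_E, Omega^2) is, by Poincare residue, the sheaf of forms
   g dx_0 / (dF/dx_1) = - g dx_1 / (dF/dx_0) with g in O_E. On fibres these are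
   Rosenlicht's regular differentials. *)
Definition dualizing_at (x : E) (w : relform) : Prop :=
  (\forall y \near nearin x, smooth_locus p y -> holomorphic_form_at y w) /\
  exists (W : set E) (O : set (T * 'rV[C]_2)) (i : E -> 'rV[C]_2)
         (F : T * 'rV[C]_2 -> C) (g : E -> C),
    let X := sub (X := prodX T (affine 2)) O in
    let pi (y : E) : T * 'rV[C]_2 := (p y, i y) in
    let dF (j : 'I_2) (y : E) := 'D_(delta_mx 0 j) (fun z => F (p y, z)) (i y) in
    [/\ [/\ open W, W x, open O & closed_embedding (X := sub W) (Y := X) pi],
        forall u : X, supp u -> germ u F,
        forall y : E, supp y -> W y -> F (pi y) = 0,
        (* F generates the ideal of E *)
        forall (y : E) (G : X -> C), supp y -> W y -> germ (r := X) (pi y) G ->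
          (\forall z \near nearin y, G (pi z) = 0) ->
          exists2 H, germ (r := X) (pi y) H &
            \forall u \near nearin (X := X) (pi y), G u = H u * F u &
        germ x g /\
        \forall y \near nearin x, smooth_locus p y -> forall D, reltan y D ->
          dF 1 y * w y D = g y * D (fun z => i z 0 0) /\
          dF 0 y * w y D = - (g y * D (fun z => i z 0 1))].

(* omega_{E/T} is isomorphic to O_E, the isomorphism being f |-> f w. *)
Definition dualizing_sheaf_trivial : Prop :=
  exists w : relform, forall x, supp x ->
    [/\ dualizing_at x w,
        forall w', dualizing_at x w' ->
          exists2 f, germ x f & form_eq_at x w' (fun y D => f y * w y D) &
        forall f, germ x f -> form_eq_at x (fun y D => f y * w y D) (fun _ _ => 0) ->
          \forall y \near nearin x, f y = 0].

(* A global section, at no x in m_x omega_{E/T, x}. *)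
Definition nowhere_vanishing_section (w : relform) : Prop :=
  forall x, supp x -> dualizing_at x w /\
    ~ exists (a : E -> C) w', [/\ germ x a, a x = 0, dualizing_at x w' &
        form_eq_at x w (fun y D => a y * w' y D)].

(* Functions f on the fibre through a smooth point y are written f = u / z with z a
   local coordinate of that fibre vanishing at y. *)

Definition near_fibre (y : E) : set_system E := nearin (X := fibre p (p y)) y.

Definition polar_presentation (y : E) (f u z : E -> C) : Prop :=
  [/\ germ y u, germ y z, z y = 0, exists2 D, reltan y D & D z != 0 &
      \forall x \near near_fibre y, x <> y -> f x = u x / z x].

Definition simple_pole (y : E) (f : E -> C) : Prop :=
  exists u z, polar_presentation y f u z.

(* If w = h dz at y then res_y (u / z) w = u(y) h(y). *)
Definition residue (w : relform) (y : E) (f : E -> C) : C :=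
  xget 0 [set c : C | exists u z, polar_presentation y f u z /\
                        forall D, reltan y D -> c * D z = u y * w y D].

End Forms.

Definition genus_one_fibration E T (p : E -> T) (i : T -> E) : Prop :=
  [/\ [/\ complex_space E, complex_space T, holmap p,
          forall x, supp x -> flat_at p x & projective_morphism p],
      holmap i /\ forall t, supp t -> p (i t) = t /\ smooth_locus p (i t),
      forall t, supp t ->
        [/\ pure_dim 1 (fibre p t), reduced_fibre p t,
            irreducible_space (fibre p t), projective_space (fibre p t) &
            arithmetic_genus (fibre p t) 1],
      exists X (pX : X -> T) (j : E -> X),
        [/\ complex_space X /\ holmap pX,
            forall x, supp x -> smooth_at 2 pX x,
            forall t, supp t -> projective_space (fibre pX t),
            closed_embedding j & forall x, supp x -> pX (j x) = p x] &
      dualizing_sheaf_trivial p /\ analytification_of_algebraic p].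


Definition lfun_trace (U : vectType C) (f : 'End(U)) : C :=
  \sum_i coord (vbasis {:U}) i (f (vbasis {:U})`_i).

Section GeometricR.
Context (E T M : rspace R) (p : E -> T) (w : relform E) (P : bundle (M * E)).

Definition homP (v v' : M) (y : E) := 'Hom(fib P (v, y), fib P (v', y)).

(* For s a section of P^v near y, F(s) = \sum_i f_i e_i near y, the f_i having at
   most simple poles at y. *)
Definition polar_expansion (v v' : M) (y : E) (F : forall x, homP v v' x)
    (s : forall x, fib P (v, x)) k (f : 'I_k -> E -> C)
    (e : 'I_k -> forall x, fib P (v', x)) : Prop :=
  [/\ forall j, simple_pole p y (f j),
      forall j, hsec (b := restr p P (p y) v') y (e j) &
      \forall x \near near_fibre p y, x <> y ->
        F x (s x) = \sum_j f j x *: e j x].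

(* F in Hom(P^v, P^v'(y)) on E_t, t = p y, given by its values on the fibres at
   the points other than y *)
Definition hom_with_pole (v v' : M) (y : E) (F : forall x, homP v v' x) : Prop :=
  (forall x s, @supp R (fibre p (p y)) x -> x <> y ->
     hsec (b := restr p P (p y) v) x s ->
     hsec (b := restr p P (p y) v') x (fun z => F z (s z))) /\
  forall s, hsec (b := restr p P (p y) v) y s ->
    exists k f e, @polar_expansion v v' y F s k f e.

Definition res_map (v v' : M) (y : E) (F : forall x, homP v v' x) : homP v v' y :=
  xget 0 [set A : homP v v' y |
    forall s, hsec (b := restr p P (p y) v) y s ->
    forall k f e, @polar_expansion v v' y F s k f e ->
      A (s y) = \sum_j residue p w y (f j) *: e j y].

(* ev_{y2} o res_{y1}^{-1} *)
Definition r_tilde (v1 v2 : M) (y1 y2 : E) (A : homP v1 v2 y1) : homP v1 v2 y2 :=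
  xget 0 [set B : homP v1 v2 y2 | exists F : forall x, homP v1 v2 x,
    [/\ hom_with_pole y1 F, res_map y1 F = A & B = F y2]].

(* A presentation \sum_nu a_nu (x) b_nu of the tensor r; what is derived from it
   below depends on the tensor only. *)
Definition r_tensor (v1 v2 : M) (y1 y2 : E) : seq (homP v2 v1 y1 * homP v1 v2 y2) :=
  xget [::] [set r : seq (homP v2 v1 y1 * homP v1 v2 y2) |
    forall A : homP v1 v2 y1,
      r_tilde y2 A = \sum_(ab <- r) lfun_trace (ab.1 \o A)%VF *: ab.2].

End GeometricR.


Section Gauge.
Context (E T M : rspace R) (p : E -> T) (q : M -> T) (w : relform E)
        (P : bundle (M * E)) (n : nat).

Definition fibrewise := forall u : M * E, 'Hom(fib P u, 'cV[C]_n).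

Definition open_in_smooth_locus (V : set (M * E)) : Prop :=
  exists2 O : set (M * E), open O &
    V = O `&` [set u | @supp R (fprod q p) u /\ smooth_locus p u.2].

Definition trivialization (V : set (M * E)) (xi : fibrewise) : Prop :=
  forall u, V u -> bijective (xi u) /\
    forall s, hsec u s <->
      forall j, @germ R (fprod q p) u (fun z => xi z (s z) j 0).

Definition holomorphic_GL (V : set (M * E)) (phi : M * E -> 'M[C]_n) : Prop :=
  forall u, V u -> phi u \in unitmx /\
    forall i j, @germ R (fprod q p) u (fun z => phi z i j).

(* (id x phi) o xi *)
Definition change_trivialization (phi : M * E -> 'M[C]_n) (xi : fibrewise)
    : fibrewise :=
  fun u => (linfun (mulmx (phi u) : 'cV[C]_n -> 'cV[C]_n) \o xi u)%VF.

Definition mx_of_lfun (f : 'End('cV[C]_n)) : 'M[C]_n :=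
  \matrix_(i, j) f (delta_mx j 0) i 0.

(* Mat_n (x) Mat_n is identified with Mat_{n^2} by the Kronecker product *t. *)
Definition r_matrix := M -> M -> E -> E -> 'M[C]_(n * n).

Definition r_triv (xi : fibrewise) : r_matrix := fun v1 v2 y1 y2 =>
  \sum_(ab <- r_tensor p w P v1 v2 y1 y2)
    mx_of_lfun (xi (v1, y1) \o ab.1 \o (xi (v2, y1))^-1)%VF *t
    mx_of_lfun (xi (v2, y2) \o ab.2 \o (xi (v1, y2))^-1)%VF.

Definition gauge_transform (phi : M * E -> 'M[C]_n) (r : r_matrix) : r_matrix :=
  fun v1 v2 y1 y2 =>
    (phi (v1, y1) *t phi (v2, y2)) *m r v1 v2 y1 y2 *m
    (invmx (phi (v2, y1)) *t invmx (phi (v1, y2))).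

Definition gauge_equivalent_via (V : set (M * E)) phi (r r' : r_matrix) : Prop :=
  forall v1 v2 y1 y2, v1 <> v2 -> y1 <> y2 ->
    V (v1, y1) -> V (v1, y2) -> V (v2, y1) -> V (v2, y2) ->
    r' v1 v2 y1 y2 = gauge_transform phi r v1 v2 y1 y2.

End Gauge.
End Spaces.

(* Main.v *)
Require Import Defs.
From HB Require Import structures.
From mathcomp Require Import all_boot all_order all_algebra.
From mathcomp Require Import all_classical all_reals all_analysis.
From mathcomp Require Import complex mxtens.
Import GRing.Theory.
Local Open Scope classical_set_scope.
Local Open Scope ring_scope.

(** The tensor r(v1, v2; y1, y2) is built from w and P alone, so passing from
    xi to zeta only changes the frames in which it is written. Where
    zeta = phi o xi, a term a (x) b of r has the zeta-matrices
    phi(v1,y1) a^xi phi(v2,y1)^-1 and phi(v2,y2) b^xi phi(v1,y2)^-1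
    ([mx_of_lfun_frames]); the Kronecker product is multiplicative, and summing
    over the terms gives the gauge transformation of r^xi by phi
    ([gauge_equivalent_change]).

    What remains is the bijection, for a fixed xi, between holomorphic maps
    phi : V -> GL_n and trivializations zeta. The map phi = zeta o xi^-1 is
    determined by zeta, and it is holomorphic ([holomorphic_transition]): its
    j-th column is the expression in the frame zeta of the section
    xi^-1(e_j), which is holomorphic because its coordinates in the frame xi
    are constant on V. Conversely phi o xi is a trivialization
    ([trivialization_change]): the two coordinate vectors of a section are
    exchanged by phi and phi^-1, and both matrices have holomorphic entries.

    The last step uses that the germs of holomorphic functions on the fibre
    product over T form a local ring: they are closed under sums, products, and
    inverses where the value is nonzero. This is not immediate, as such a germ
    is presented as F(a, b) with F holomorphic on some C^(k+l) depending on
    the germ, and two germs are combined after pulling both functions F back to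
    a common affine space ([germ_prodX_pair]). It also uses that V is a
    neighbourhood, in the fibre product, of each of its points, since
    smoothness of p is an open condition ([near_open_in_smooth_locus]). *)

(** * Holomorphic functions on affine spaces *)

Section NearDifferentiable.
Context {K : numFieldType}.

Lemma colsub_continuous m n (s : 'I_n -> 'I_m) :
  continuous (colsub s : 'rV[K]_m -> 'rV[K]_n).
Proof.
move=> z A /nbhs_ballP[e e0 eA]; apply/nbhs_ballP; exists e => //= y.
move=> zy; apply: eA; case: zy => _ zy; split=> // i j; rewrite !mxE; exact: zy.
Qed.

(** Pulling back along a coordinate projection lets functions of different
    families of coordinates be viewed on one affine space. *)
Lemma near_differentiable_colsub {m n} (s : 'I_n -> 'I_m) (z : 'rV[K]_m)
    (F : 'rV[K]_n -> K) :
  (\forall v \near colsub s z, differentiable F v) ->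
  \forall v \near z, differentiable (F \o colsub s) v.
Proof.
move=> /(@colsub_continuous _ _ s z) dF.
apply: (@filterS _ _ (nbhs_filter z) _ _ _ dF) => v dFv.
have ds : differentiable (colsub s : 'rV[K]_m -> 'rV[K]_n) v.
  exact/linear_differentiable/colsub_continuous.
exact: differentiable_comp ds dFv.
Qed.

Lemma near_differentiableV {m} (z : 'rV[K]_m) (F : 'rV[K]_m -> K) :
  (\forall v \near z, differentiable F v) -> F z != 0 ->
  \forall v \near z, differentiable (fun v => (F v)^-1) v.
Proof.
move=> dF Fz0.
have Fc : F v @[v --> z] --> F z.
  exact/differentiable_continuous/(nbhs_singleton dF).
have F0 : \forall v \near z, F v != 0 by exact: cvgr_neq0 Fc Fz0.
by apply: filterS2 dF F0 => v; exact: differentiableV.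
Qed.

Lemma near_differentiableD {m} (z : 'rV[K]_m) (F G : 'rV[K]_m -> K) :
  (\forall v \near z, differentiable F v) ->
  (\forall v \near z, differentiable G v) ->
  \forall v \near z, differentiable (F + G) v.
Proof. by move=> dF dG; apply: filterS2 dF dG => v; exact: differentiableD. Qed.

Lemma near_differentiableM {m} (z : 'rV[K]_m) (F G : 'rV[K]_m -> K) :
  (\forall v \near z, differentiable F v) ->
  (\forall v \near z, differentiable G v) ->
  \forall v \near z, differentiable (F * G) v.
Proof. by move=> dF dG; apply: filterS2 dF dG => v; exact: differentiableM. Qed.

Lemma near_differentiable_cst {m} (z : 'rV[K]_m) (c : K) :
  \forall v \near z, differentiable (fun=> c) v.
Proof.
by apply: (nearW _ (F := nbhs z)) => v; exact: differentiable_cst.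
Qed.

End NearDifferentiable.

(** * Germs on a product *)

Section GermAlgebra.
Context {R : realType}.
Local Notation C := (Cplx R).

Section Product.
Context {X Y : rspace R}.
Implicit Types (u : X * Y) (f g : X * Y -> C).
Local Notation germXY := (@germ R (prodX X Y)).

Definition jcoord {k l} (a : 'I_k -> X -> C) (b : 'I_l -> Y -> C) (v : X * Y)
    : 'rV[C]_(k + l) :=
  row_mx (\row_i a i v.1) (\row_j b j v.2).

(** Two presentations F(a1, b1) and G(a2, b2) become presentations by the same
    functions once the families are concatenated: F and G are composed with the
    coordinate projections onto the blocks they depend on. *)
Lemma germ_prodX_pair u f g : germXY u f -> germXY u g ->
  exists (k l : nat) (a : 'I_k -> X -> C) (b : 'I_l -> Y -> C)
         (F G : 'rV[C]_(k + l) -> C),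
    [/\ forall i, germ u.1 (a i), forall j, germ u.2 (b j),
        \forall v \near jcoord a b u, differentiable F v,
        \forall v \near jcoord a b u, differentiable G v &
        \forall v \near within (@supp R X `*` @supp R Y) (nbhs u),
          f v = F (jcoord a b v) /\ g v = G (jcoord a b v)].
Proof.
move=> [k1 [l1 [a1 [b1 [F [ha1 hb1 hF fE]]]]]].
move=> [k2 [l2 [a2 [b2 [G [ha2 hb2 hG gE]]]]]].
pose cat m1 m2 S (c1 : 'I_m1 -> S) (c2 : 'I_m2 -> S) (i : 'I_(m1 + m2)) :=
  match fintype.split i with inl i1 => c1 i1 | inr i2 => c2 i2 end.
(* The k1 + k2 coordinates on X come first, so the blocks of F are the positions
   (X, first) and (Y, first), and those of G are (X, second) and (Y, second). *)
pose s1 (i : 'I_(k1 + l1)) : 'I_((k1 + k2) + (l1 + l2)) :=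
  match fintype.split i with inl x => lshift _ (lshift _ x)
                           | inr y => rshift _ (lshift _ y) end.
pose s2 (i : 'I_(k2 + l2)) : 'I_((k1 + k2) + (l1 + l2)) :=
  match fintype.split i with inl x => lshift _ (rshift _ x)
                           | inr y => rshift _ (rshift _ y) end.
pose a := cat _ _ _ a1 a2; pose b := cat _ _ _ b1 b2.
have catl m1 m2 S (c1 : 'I_m1 -> S) (c2 : 'I_m2 -> S) i :
    cat _ _ _ c1 c2 (lshift _ i) = c1 i.
  by rewrite /cat (unsplitK (inl _ i)).
have catr m1 m2 S (c1 : 'I_m1 -> S) (c2 : 'I_m2 -> S) i :
    cat _ _ _ c1 c2 (rshift _ i) = c2 i.
  by rewrite /cat (unsplitK (inr _ i)).
have sel1 v : colsub s1 (jcoord a b v) = jcoord a1 b1 v.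
  apply/rowP => i; rewrite -(splitK i) mxE /s1 unsplitK.
  by case: fintype.split => j /=; rewrite ?row_mxEl ?row_mxEr !mxE ?/a ?/b catl.
have sel2 v : colsub s2 (jcoord a b v) = jcoord a2 b2 v.
  apply/rowP => i; rewrite -(splitK i) mxE /s2 unsplitK.
  by case: fintype.split => j /=; rewrite ?row_mxEl ?row_mxEr !mxE ?/a ?/b catr.
exists (k1 + k2)%N, (l1 + l2)%N, a, b, (F \o colsub s1), (G \o colsub s2); split.
- by move=> i; rewrite /a /cat; case: fintype.split.
- by move=> j; rewrite /b /cat; case: fintype.split.
- by apply: near_differentiable_colsub; rewrite sel1.
- by apply: near_differentiable_colsub; rewrite sel2.
- by apply: filterS2 fE gE => v -> ->; rewrite /= sel1 sel2.
Qed.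

Lemma germ_prodX_cst u c : germXY u (fun=> c).
Proof.
exists 0%N, 0%N, (fun _ _ => 0), (fun _ _ => 0), (fun=> c).
split=> [[] // | [] // | | ]; last by apply: nearW.
exact: near_differentiable_cst.
Qed.

Lemma germ_prodXD u f g : germXY u f -> germXY u g ->
  germXY u (fun v => f v + g v).
Proof.
move=> hf hg; have [k [l [a [b [F [G [ha hb hF hG e]]]]]]] :=
  germ_prodX_pair u f g hf hg.
exists k, l, a, b, (F + G); split=> //.
  exact: near_differentiableD.
by apply: filterS e => v [-> ->].
Qed.

Lemma germ_prodXM u f g : germXY u f -> germXY u g ->
  germXY u (fun v => f v * g v).
Proof.
move=> hf hg; have [k [l [a [b [F [G [ha hb hF hG e]]]]]]] :=
  germ_prodX_pair u f g hf hg.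
exists k, l, a, b, (F * G); split=> //.
  exact: near_differentiableM.
by apply: filterS e => v [-> ->].
Qed.

Lemma germ_prodXV u f : @supp R (prodX X Y) u -> germXY u f -> f u != 0 ->
  germXY u (fun v => (f v)^-1).
Proof.
move=> su [k [l [a [b [F [ha hb hF e]]]]]] fu0.
have Fu0 : F (jcoord a b u) != 0.
  move: e; rewrite near_withinE => /nbhs_singleton /(_ su) fuE.
  by rewrite -fuE.
exists k, l, a, b, (fun z => (F z)^-1); split=> //; last first.
  by apply: filterS e => v ->.
exact: near_differentiableV.
Qed.

End Product.
End GermAlgebra.

(** * Germs on a subspace of a product *)

Section GermSubspace.
Context {R : realType} {X Y : rspace R} {A : set (prodX X Y)}.
Local Notation C := (Cplx R).
Local Notation Z := (sub A).
Implicit Types (u : X * Y) (f g : X * Y -> C).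
Local Notation germZ := (@germ R Z).
Local Notation nearZ u := (within (@supp R Z) (nbhs (u : X * Y))).

(** Only values on the support matter, which is what allows identities valid only
    on V to be used for germs. *)
Lemma germ_sub_eq {u f g} :
  (\forall v \near nearZ u, f v = g v) -> germZ u f -> germZ u g.
Proof.
by move=> fg [h hh fh]; exists h => //; apply: filterS2 fg fh => v <-.
Qed.

Lemma germ_sub_cst u c : germZ u (fun=> c).
Proof. by exists (fun=> c); [exact: germ_prodX_cst | exact: nearW]. Qed.

Lemma germ_subD {u f g} : germZ u f -> germZ u g -> germZ u (fun v => f v + g v).
Proof.
move=> [f' hf ff'] [g' hg gg']; exists (fun v => f' v + g' v).
  exact: germ_prodXD.
by apply: filterS2 ff' gg' => v -> ->.
Qed.

Lemma germ_subM {u f g} : germZ u f -> germZ u g -> germZ u (fun v => f v * g v).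
Proof.
move=> [f' hf ff'] [g' hg gg']; exists (fun v => f' v * g' v).
  exact: germ_prodXM.
by apply: filterS2 ff' gg' => v -> ->.
Qed.

Lemma germ_subV {u f} : supp (r := Z) u -> germZ u f -> f u != 0 ->
  germZ u (fun v => (f v)^-1).
Proof.
move=> su [g hg fg] fu0; have fgu : f u = g u.
  by move: fg; rewrite near_withinE => /nbhs_singleton; exact.
exists (fun v => (g v)^-1); last by apply: filterS fg => v ->.
by apply: germ_prodXV => //; [case: su | rewrite -fgu].
Qed.

Lemma germ_sub_sum {I} (r : seq I) (Q : pred I) {u} {F : I -> X * Y -> C} :
  (forall i, Q i -> germZ u (F i)) -> germZ u (fun v => \sum_(i <- r | Q i) F i v).
Proof.
move=> hF; elim: r => [|i r IHr].
  by under eq_fun do rewrite big_nil; exact: germ_sub_cst.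
under eq_fun do rewrite big_cons; case: (boolP (Q i)) => // Qi.
by apply: germ_subD => //; exact: hF.
Qed.

Lemma germ_sub_prod {I} (r : seq I) (Q : pred I) {u} {F : I -> X * Y -> C} :
  (forall i, Q i -> germZ u (F i)) ->
  germZ u (fun v => \prod_(i <- r | Q i) F i v).
Proof.
move=> hF; elim: r => [|i r IHr].
  by under eq_fun do rewrite big_nil; exact: germ_sub_cst.
under eq_fun do rewrite big_cons; case: (boolP (Q i)) => // Qi.
by apply: germ_subM => //; exact: hF.
Qed.

Definition mx_germ {m n} u (B : X * Y -> 'M[C]_(m, n)) : Prop :=
  forall i j, germZ u (fun v => B v i j).

Lemma mx_germM {m n k u} {B : X * Y -> 'M[C]_(m, n)} {D : X * Y -> 'M[C]_(n, k)} :
  mx_germ u B -> mx_germ u D -> mx_germ u (fun v => B v *m D v).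
Proof.
move=> hB hD i j; under eq_fun do rewrite mxE.
by apply: germ_sub_sum => a _; exact: germ_subM.
Qed.

Lemma germ_det {m u} {B : X * Y -> 'M[C]_m} :
  mx_germ u B -> germZ u (fun v => \det (B v)).
Proof.
move=> hB; apply: germ_sub_sum => s _; apply: germ_subM.
  exact: germ_sub_cst.
by apply: germ_sub_prod => i _; exact: hB.
Qed.

(** Cramer's rule, rather than [invmx], which is defined by cases on the
    invertibility of B v: this formula is built uniformly in v from sums, products
    and one inverse of the entries. *)
Lemma mx_germ_inv {m u} {B : X * Y -> 'M[C]_m} :
  supp (r := Z) u -> mx_germ u B -> B u \in unitmx ->
  mx_germ u (fun v => (\det (B v))^-1 *: \adj (B v)).
Proof.
rewrite unitmxE unitfE => su hB Bu i j; under eq_fun do rewrite !mxE.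
apply: germ_subM; first by apply: germ_subV => //; exact: germ_det.
apply: germ_subM; first exact: germ_sub_cst.
apply: germ_det => a b; under eq_fun do rewrite !mxE; exact: hB.
Qed.

End GermSubspace.

(** * Bijective linear maps and matrices *)

Section LinearAlgebra.
Context {K : fieldType}.

Lemma bij_lfunK {U W : vectType K} {f : 'Hom(U, W)} :
  bijective f -> cancel f (f^-1)%VF.
Proof. by move=> /bij_inj/lker0P/lker0_lfunK. Qed.

Lemma bij_lfunVK {U W : vectType K} {f : 'Hom(U, W)} :
  bijective f -> cancel (f^-1)%VF f.
Proof.
by move=> bf y; case: (bf) => g _ gK; rewrite -{1}[y]gK bij_lfunK// gK.
Qed.

Lemma bij_lfunV {U W : vectType K} {f : 'Hom(U, W)} :
  bijective f -> bijective (f^-1)%VF.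
Proof. by move=> bf; exists f; [exact: bij_lfunVK | exact: bij_lfunK]. Qed.

Lemma bij_comp_lfun {U W Z : vectType K} {g : 'Hom(W, Z)} {f : 'Hom(U, W)} :
  bijective g -> bijective f -> bijective (g \o f)%VF.
Proof.
move=> bg bf; apply: (@eq_bij _ _ (g \o f)); first exact: bij_comp.
by move=> x; rewrite comp_lfunE.
Qed.

(** For a general linear map, [f^-1] is only a chosen section over the image of f,
    and such choices need not be compatible with composition; bijectivity leaves
    no choice. *)
Lemma inv_comp_lfun {U W Z : vectType K} {g : 'Hom(W, Z)} {f : 'Hom(U, W)} :
  bijective g -> bijective f -> ((g \o f)^-1 = f^-1 \o g^-1)%VF.
Proof.
move=> bg bf; have bgf := bij_comp_lfun bg bf; apply/lfunP => y.
by apply: (bij_inj bgf); rewrite bij_lfunVK// !comp_lfunE !bij_lfunVK.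
Qed.

End LinearAlgebra.

Section MatricesOfMaps.
Context {R : realType} {n : nat}.
Local Notation C := (Cplx R).
Implicit Types (f g : 'End('cV[C]_n)) (B : 'M[C]_n).

Definition mul_lfun B : 'End('cV[C]_n) := linfun (mulmx B : 'cV[C]_n -> 'cV[C]_n).

Lemma mul_lfunE B x : mul_lfun B x = B *m x.
Proof. by rewrite lfunE. Qed.

Lemma mul_mx_of_lfun f x : mx_of_lfun f *m x = f x.
Proof.
have xE : x = \sum_j x j 0 *: delta_mx j 0.
  by rewrite {1}[x]matrix_sum_delta; apply: eq_bigr => j _; rewrite big_ord1.
rewrite {2}xE linear_sum; apply/colP => k.
rewrite mxE summxE; apply: eq_bigr => j _.
by rewrite linearZ !mxE mulrC.
Qed.

Lemma mul_lfunK : cancel mul_lfun (@mx_of_lfun R n).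
Proof. by move=> B; apply/matrixP => k j; rewrite mxE mul_lfunE -colE mxE. Qed.

Lemma mx_of_lfunK : cancel (@mx_of_lfun R n) mul_lfun.
Proof. by move=> f; apply/lfunP => x; rewrite mul_lfunE mul_mx_of_lfun. Qed.

Lemma mx_of_lfun_comp f g : mx_of_lfun (f \o g)%VF = mx_of_lfun f *m mx_of_lfun g.
Proof.
apply: (can_inj mul_lfunK); apply/lfunP => x.
by rewrite !mul_lfunE -mulmxA !mul_mx_of_lfun comp_lfunE.
Qed.

Lemma mul_lfun_bij B : B \in unitmx -> bijective (mul_lfun B).
Proof.
move=> Bu; exists (mul_lfun (invmx B)) => x; rewrite !mul_lfunE.
  exact: mulKmx.
exact: mulKVmx.
Qed.

Lemma mul_lfunV B : B \in unitmx -> (mul_lfun B)^-1%VF = mul_lfun (invmx B).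
Proof.
move=> Bu; apply/lfunP => x; apply: (bij_inj (mul_lfun_bij _ Bu)).
by rewrite (bij_lfunVK (mul_lfun_bij _ Bu)) !mul_lfunE mulKVmx.
Qed.

Lemma unitmx_mx_of_lfun f : bijective f -> mx_of_lfun f \in unitmx.
Proof.
move=> bf; apply: (proj1 (mulmx1_unit (B := mx_of_lfun f^-1%VF) _)).
rewrite -mx_of_lfun_comp; apply: (can_inj mul_lfunK); apply/lfunP => x.
by rewrite mx_of_lfunK mul_lfunE mul1mx comp_lfunE bij_lfunVK.
Qed.

(** Each leg of a tensor a (x) b is a map between fibres of P at two different
    points, so the change of frame acts by different matrices on its two sides. *)
Lemma mx_of_lfun_frames {U W : vectType C} {x1 : 'Hom(W, 'cV[C]_n)}
    {x2 : 'Hom(U, 'cV[C]_n)} {B1 B2 : 'M[C]_n} (a : 'Hom(U, W)) :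
  bijective x2 -> B2 \in unitmx ->
  mx_of_lfun ((mul_lfun B1 \o x1) \o a \o (mul_lfun B2 \o x2)^-1)%VF =
  B1 *m mx_of_lfun (x1 \o a \o x2^-1)%VF *m invmx B2.
Proof.
move=> b2 B2u; rewrite inv_comp_lfun//; last exact: mul_lfun_bij.
rewrite mul_lfunV// -{2}[B1]mul_lfunK -{2}[invmx B2]mul_lfunK.
by rewrite -!mx_of_lfun_comp !comp_lfunA.
Qed.

End MatricesOfMaps.

(** * Trivializations and gauge transformations *)

Section Trivializations.
Context {R : realType} {E T M : rspace R} {p : E -> T} {q : M -> T}.
Context {P : @bundle R (M * E)} {n : nat} {V : set (M * E)}.
Local Notation C := (Cplx R).
Local Notation overT := [set z : prodX M E | q z.1 = p z.2].
Local Notation near_u u := (within (@supp R (Defs.fprod q p)) (nbhs (u : M * E))).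

(** A product chart of p around a point is also one around every nearby point. *)
Lemma near_open_in_smooth_locus {u} : open_in_smooth_locus p q V -> V u ->
  \forall z \near near_u u, V z.
Proof.
case=> N oN ->; case=> Nu; case=> su; case=> su2.
case=> W; case=> D; case=> h; case=> h'; case=> oW Wu oD bh hp.
have nN : \forall z \near u, N z by exact: open_nbhs_nbhs.
have nW : \forall z \near u, W z.2.
  have : \forall y \near u.2, W y by exact: open_nbhs_nbhs.
  exact: cvg_snd.
rewrite near_withinE; apply: filterS2 nN nW => z Nz Wz sz; split=> //.
split=> //; split; first by case: sz => -[].
by exists W, D, h, h'.
Qed.

(** One presentation of r, chosen independently of the trivialization, underlies
    both matrices, so the identity holds term by term. *)
Lemma gauge_equivalent_change (w : relform E) (xi zeta : fibrewise P n)
    (phi : M * E -> 'M[C]_n) :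
  (forall u, V u -> bijective (xi u)) -> (forall u, V u -> phi u \in unitmx) ->
  (forall u, V u -> zeta u = change_trivialization phi xi u) ->
  gauge_equivalent_via V phi (r_triv p w xi) (r_triv p w zeta).
Proof.
move=> bxi uphi zE v1 v2 y1 y2 _ _ V11 V12 V21 V22.
rewrite /gauge_transform /r_triv mulmx_sumr mulmx_suml.
apply: eq_bigr => ab _; rewrite !zE// !tensmx_mul.
by congr (_ *t _); apply: mx_of_lfun_frames; auto.
Qed.

(** The frame xi^-1(e_j) consists of holomorphic sections, and its zeta-coordinates
    are the columns of the transition matrix. *)
Lemma holomorphic_transition {xi zeta : fibrewise P n} :
  open_in_smooth_locus p q V ->
  trivialization p q V xi -> trivialization p q V zeta ->
  holomorphic_GL p q V (fun u => mx_of_lfun (zeta u \o (xi u)^-1)%VF).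
Proof.
move=> oV txi tzeta u Vu; have [bxi hxi] := txi u Vu; have [bz hz] := tzeta u Vu.
split; first exact/unitmx_mx_of_lfun/bij_comp_lfun/bij_lfunV.
move=> k j; pose s z := ((xi z)^-1)%VF (delta_mx j 0 : 'cV[C]_n).
have : hsec u s.
  apply/hxi => l; apply: germ_sub_eq (germ_sub_cst u ((delta_mx j 0 : 'cV[C]_n) l 0)).
  apply: filterS (near_open_in_smooth_locus oV Vu) => z Vz.
  by rewrite /s bij_lfunVK//; case: (txi z Vz).
move=> /hz/(_ k); apply: germ_sub_eq; apply: nearW => z.
by rewrite mxE comp_lfunE.
Qed.

(** The coordinates of a section in the new frame are phi times the old ones, so
    they are holomorphic together, phi and phi^-1 both being holomorphic. *)
Lemma trivialization_change {xi : fibrewise P n} {phi : M * E -> 'M[C]_n} :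
  open_in_smooth_locus p q V -> trivialization p q V xi ->
  holomorphic_GL p q V phi ->
  trivialization p q V (change_trivialization phi xi).
Proof.
move=> oV txi hphi u Vu; have [bxi hxi] := txi u Vu; have [pu gphi] := hphi u Vu.
split; first exact: bij_comp_lfun (mul_lfun_bij _ pu) bxi.
have su : @supp R (Defs.fprod q p) u by case: oV Vu => N _ -> [_ []].
move=> s; apply: (iff_trans (hxi s)).
pose c z : 'cV[C]_n := xi z (s z).
have zE z : change_trivialization phi xi z (s z) = phi z *m c z.
  by rewrite comp_lfunE; exact: mul_lfunE.
split=> hs j.
- have hc : mx_germ (A := overT) u c by move=> a b; rewrite (ord1 b); exact: hs.
  under eq_fun do rewrite zE; exact: (mx_germM (A := overT) gphi hc).
- have hc : mx_germ (A := overT) u (fun z => phi z *m c z).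
    move=> a b; rewrite (ord1 b); apply: germ_sub_eq (hs a).
    by apply: nearW => z; rewrite zE.
  apply: germ_sub_eq (mx_germM (A := overT) (mx_germ_inv su gphi pu) hc j 0).
  apply: filterS (near_open_in_smooth_locus oV Vu) => z Vz.
  have [pz _] := hphi z Vz.
  have -> : (\det (phi z))^-1 *: \adj (phi z) = invmx (phi z) by rewrite /invmx pz.
  by rewrite mulKmx.
Qed.

End Trivializations.

Theorem proposition6p12 (R : realType) (E T : rspace R) (p : E -> T) (i : T -> E)
    (n : nat) (d : int) (M : rspace R) (q : M -> T) (P : bundle (M * E))
    (w : relform E) (V : set (M * E)) (o : M * E) :
  genus_one_fibration p i ->
  coprimez n%:Z d ->
  moduli_space p n d q P ->
  nowhere_vanishing_section p w ->
  open_in_smooth_locus p q V -> V o ->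
  (forall xi zeta : fibrewise P n,
     trivialization p q V xi -> trivialization p q V zeta ->
     (exists phi : M * E -> 'M[Cplx R]_n,
        [/\ holomorphic_GL p q V phi,
            forall u, V u -> zeta u = change_trivialization phi xi u &
            forall phi' : M * E -> 'M[Cplx R]_n,
              (forall u, V u -> zeta u = change_trivialization phi' xi u) ->
              forall u, V u -> phi' u = phi u]) /\
     (forall phi : M * E -> 'M[Cplx R]_n,
        holomorphic_GL p q V phi ->
        (forall u, V u -> zeta u = change_trivialization phi xi u) ->
        gauge_equivalent_via V phi (r_triv p w xi) (r_triv p w zeta))) /\
  (forall (xi : fibrewise P n) (phi : M * E -> 'M[Cplx R]_n),
     trivialization p q V xi -> holomorphic_GL p q V phi ->
     trivialization p q V (change_trivialization phi xi) /\
     gauge_equivalent_via V phi (r_triv p w xi)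
       (r_triv p w (change_trivialization phi xi))).
Proof.
move=> _ _ _ _ oV _; split=> [xi zeta txi tzeta | xi phi txi hphi]; last first.
  split; first exact: trivialization_change.
  by apply: gauge_equivalent_change => // u Vu; [case: (txi u Vu) | case: (hphi u Vu)].
have bxi u : V u -> bijective (xi u) by move=> /txi[].
split=> [|phi hphi zE]; last first.
  by apply: gauge_equivalent_change => // u Vu; case: (hphi u Vu).
exists (fun u => mx_of_lfun (zeta u \o (xi u)^-1)%VF); split.
- exact: holomorphic_transition.
- move=> u Vu; apply/lfunP => x; rewrite comp_lfunE -/(mul_lfun _) mx_of_lfunK.
  by rewrite comp_lfunE bij_lfunK//; exact: bxi.
- move=> phi' zE u Vu; rewrite zE// -[LHS]mul_lfunK; congr mx_of_lfun.
  by apply/lfunP => x; rewrite !comp_lfunE bij_lfunVK//; exact: bxi.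
Qed.
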